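(* The algebraic curvature tensors $R$ on a complex model $(V,\langle\cdot,\cdot\rangle,J)$ that are K\''ahler and almost isotropic with associated constant $\kappa$ are classified as follows. \begin{enumerate} \item If $\dim(V)=2$, then $R=\kappa R_1=\frac{\kappa}{4}(R_1+R_J)$. \item If $\dim(V)=4$ and $\kappa\neq 0$, then there exist constants $\tau=\pm1$ and $\mu_1,\mu_2\in\mathbf{R}$ and orthogonal holomorphic planes $W_1$ and $W_2$ such that $\mu_1\cdot\mu_2=\kappa/\tau$, and letting $A=J\circ(\mu_1\pi^{W_1}+\mu_2\pi^{W_2})$, $R=\kappa R_1+\tau R_A$. \item If $\dim(V)\geq 6$ and $\kappa\neq 0$, then $R=\kappa(R_1+R_J)$. \item If $\dim(V)\geq 4$ and $\kappa=0$, then there exist $c\in\mathbf{R}$ and a holomorphic plane $W$ such that, letting $A=J\circ\pi^W$, $R=cR_A$. \end{enumerate}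
   Context: A complex model $(V,\langle\cdot,\cdot\rangle,J)$ consists of an even-dimensional real inner product space $(V,\langle\cdot,\cdot\rangle)$ and an orthogonal almost complex structure $J:V\to V$ (that is, $J$ is orthogonal and $J^2=-\operatorname{Id}$). A holomorphic plane is a two-dimensional $J$-invariant subspace of $V$. For a subspace $W$ of $V$, $\pi^W:V\to W$ denotes the orthogonal projection of $V$ onto $W$. An algebraic curvature tensor on $V$ is a tensor $R:V^3\to V$, $(x,y,z)\mapsto R(x,y)z$, satisfying $\langle R(x,y)z,w\rangle=-\langle R(y,x)z,w\rangle=\langle R(z,w)x,y\rangle$ and $R(x,y)z+R(y,z)x+R(z,x)y=0$. It is K\''ahler if it also satisfies $R(x,y)z=R(Jx,Jy)z$ for all $x,y,z\in V$. For a unit vector $v\in V$, the Jacobi operator $\mathcal{J}_v:v^\perp\to v^\perp$ is the symmetric endomorphism $\mathcal{J}_v(w)=R(w,v)v$. $R$ is almost isotropic with associated constant $\kappa\in\mathbf{R}$ if $\operatorname{rank}(\mathcal{J}_v-\kappa\operatorname{Id}_{v^\perp})\leq 1$ for each unit vector $v\in V$. The tensor $R_1$ is defined by $R_1(x,y)z=\langle y,z\rangle x-\langle x,z\rangle y$, and for a skew symmetric endomorphism $A:V\to V$ the tensor $R_A$ is defined by $R_A(x,y)z=2\langle x,Ay\rangle Az+\langle x,Az\rangle Ay-\langle y,Az\rangle Ax$; $R_J$ is the case $A=J$.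
   Formalization: In item 1 (dim V = 2) every κ is an associated constant, so R = κR_1 fails for the given κ (e.g. R = R_1, κ = 0); what is proved is that R = kR_1 = (k/4)(R_1+R_J) for some associated constant k; each item is proved as an equivalence. *)

(* Defs.v *)
From mathcomp Require Import all_boot all_order all_algebra.
From mathcomp Require Import reals.

Set Implicit Arguments.
Unset Strict Implicit.
Unset Printing Implicit Defensive.

Import GRing.Theory Num.Theory.
Local Open Scope ring_scope.

Section ComplexModel.
Variables (R : realType) (V : vectType R) (ip : {dot V for idfun}).
Variable J : 'End(V).

Definition almost_complex_structure : Prop :=
  isometry ip ip J /\ (J \o J)%VF = - \1%VF.

Definition complex_model : Prop :=
  ~~ odd (\dim {:V}) /\ almost_complex_structure.

Definition holomorphic_plane (W : {vspace V}) : Prop :=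
  \dim W = 2 /\ (J @: W <= W)%VS.

Definition orthogonal_spaces (W1 W2 : {vspace V}) : Prop :=
  (W1 <= orthov ip W2)%VS.

Definition orthoproj (W : {vspace V}) : 'End(V) := daddv_pi W (orthov ip W).

Implicit Type Rm : V -> V -> V -> V.

Definition trilinear Rm : Prop :=
  [/\ forall y z, linear (fun x => Rm x y z),
      forall x z, linear (fun y => Rm x y z) &
      forall x y, linear (fun z => Rm x y z)].

Definition algebraic_curvature_tensor Rm : Prop :=
  [/\ trilinear Rm,
      forall x y z w, ip (Rm x y z) w = - ip (Rm y x z) w,
      forall x y z w, ip (Rm x y z) w = ip (Rm z w x) y &
      forall x y z, Rm x y z + Rm y z x + Rm z x y = 0].

Definition kahler Rm : Prop :=
  forall x y z, Rm x y z = Rm (J x) (J y) z.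

(* For an algebraic curvature tensor, [jacobi Rm v] takes values in v^⊥; the
   Jacobi operator of v is its restriction to v^⊥. *)
Definition jacobi Rm (v : V) : 'End(V) := linfun (fun w => Rm w v v).

(* The rank of an endomorphism of v^⊥ is the dimension of the image of v^⊥. *)
Definition almost_isotropic (kappa : R) Rm : Prop :=
  forall v, ip v v = 1 ->
    (\dim ((jacobi Rm v - kappa *: \1%VF) @: orthov ip <[v]>)%VS <= 1)%N.

Definition kahler_almost_isotropic (kappa : R) Rm : Prop :=
  [/\ algebraic_curvature_tensor Rm, kahler Rm & almost_isotropic kappa Rm].

Definition tensor1 (x y z : V) : V := ip y z *: x - ip x z *: y.

Definition tensorA (A : 'End(V)) (x y z : V) : V :=
  (2 * ip x (A y)) *: A z + ip x (A z) *: A y - ip y (A z) *: A x.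

End ComplexModel.

(* Main.v *)
Require Import Defs.
From HB Require Import structures.
From mathcomp Require Import all_boot all_order all_algebra.
From mathcomp Require Import reals.
From mathcomp Require Import boolp ring lra.

(** Subtract the constant curvature part: D = R - kappa R_1 is an algebraic
    curvature tensor whose Jacobi operators all have rank at most 1, so that
    the 2x2 minors of the form q_v(w) = <D(w,v)v,w> in w vanish for every v.
    As q is also quadratic in v and symmetric in the two arguments, it is a
    constant times the square of one bilinear form: fix w0 with q_v(w0) not
    identically zero, so that q_v(w0) = s lam(v)^2 for a linear form lam; the
    mixed term <D(w0,v)v,w> vanishes on ker lam, hence is lam(v) <Av,w> for a
    linear map A, and the minor condition turns into s q_v(w) = <Av,w>^2.
    Since q_v(v) = 0 the map A is skew, and since an algebraic curvature tensor
    is determined by q, one gets R = kappa R_1 + c R_A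
    ([almost_isotropic_model]).

    The Kahler identity makes sectional curvature J-invariant, so that
    <Av,w>^2 = <AJv,Jw>^2 when c <> 0.  A product of two bilinear forms vanishes
    only if one factor does, so A commutes or anticommutes with J; the second
    case forces A = 0 ([kahler_skew_commute]).  Hence A = JS with S symmetric
    and complex linear, and with the notation
      N(x,y) = R_1(x,y) - R_1(Jx,Jy)
    the Kahler identity becomes kappa N(x,y) = c N(Sx,Sy)
    ([kahler_almost_isotropicP], an equivalence in every dimension).

    What is left is linear algebra on S.  If x and y are eigenvectors of S on
    orthogonal complex lines, the identity says that kappa is c times the
    product of the eigenvalues.  In real dimension 2, S is a scalar and
    R_J = 3 R_1.  If kappa = 0 and R <> 0, S is a multiple of the projection to
    a holomorphic plane.  If kappa <> 0 and the dimension is at least 4, S has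
    an eigenvector y, is a scalar l on its complex line and a scalar m on the
    orthogonal complement, with c l m = kappa ([balanced_eigenspaces]); in
    dimension at least 6 the complement contains two orthogonal complex lines,
    whence c m^2 = kappa too and S is a scalar. *)

Set Implicit Arguments.
Unset Strict Implicit.
Unset Printing Implicit Defensive.

Import Order.TTheory GRing.Theory Num.Theory.
Local Open Scope ring_scope.

(** * Inner products and endomorphisms *)

Section InnerProduct.
Variables (R : realType) (V : vectType R) (ip : {dot V for idfun}).
Implicit Types (u v w x y z : V) (a b c : R) (A B C : 'End(V)) (W : {vspace V}).

Lemma ipC u v : ip u v = ip v u.
Proof. by rewrite (hermC ip) /= expr0 mul1r. Qed.

Lemma ipDl u v w : ip (u + v) w = ip u w + ip v w.
Proof. exact: linearDl. Qed.

Lemma ipZl a u w : ip (a *: u) w = a * ip u w.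
Proof. exact: linearZl_LR. Qed.

Lemma ipNl u w : ip (- u) w = - ip u w.
Proof. exact: linearNl. Qed.

Lemma ipDr u v w : ip w (u + v) = ip w u + ip w v.
Proof. exact: linearDr. Qed.

Lemma ipZr a u w : ip w (a *: u) = a * ip w u.
Proof. by rewrite ipC ipZl ipC. Qed.

Lemma ipNr u w : ip w (- u) = - ip w u.
Proof. exact: linearNr. Qed.

Lemma ip0l u : ip 0 u = 0.
Proof. exact: linear0l. Qed.

Lemma ip0r u : ip u 0 = 0.
Proof. exact: linear0r. Qed.

Definition ipE := (ipDl, ipDr, ipZl, ipZr, ipNl, ipNr, ip0l, ip0r).

Lemma mem_orthov_line u v : (u \in orthov ip <[v]>%VS) = (ip u v == 0).
Proof. exact: mem_orthov1. Qed.

Lemma mem_orthov W u :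
  (u \in orthov ip W) <-> (forall v, v \in W -> ip u v = 0).
Proof. by split=> [/mem_orthovP|H]; last apply/mem_orthovP. Qed.

Lemma lfunD A u v : A (u + v) = A u + A v. Proof. exact: linearD. Qed.

Lemma lfunZ A a u : A (a *: u) = a *: A u. Proof. exact: linearZ. Qed.

Lemma lfunN A u : A (- u) = - A u. Proof. exact: linearN. Qed.

Lemma lfun0 A : A 0 = 0. Proof. exact: linear0. Qed.

Definition mapE := (lfunD, lfunZ, lfunN, lfun0).

Lemma ip_eq0 u : (ip u u == 0) = (u == 0).
Proof.
have [->|u0] := eqVneq u 0; first by rewrite ip0l eqxx.
by rewrite gt_eqF // (@neq0_dnorm_gt0 _ _ _ ip).
Qed.

Lemma ip_inj u v : (forall w, ip u w = ip v w) -> u = v.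
Proof.
move=> H; apply/eqP; rewrite -subr_eq0 -ip_eq0.
by rewrite ipDl ipNl H subrr.
Qed.

(** [linfun] is total on functions, but its computation rule asks for a linear
    structure; this form asks for a proof of linearity instead. *)
Lemma linfunE (f : V -> V) : linear f -> linfun f =1 f.
Proof.
move=> lin_f.
pose m := GRing.isLinear.Build R V V *:%R f lin_f.
pose g : {linear V -> V} := HB.pack f m.
exact: (lfunE g).
Qed.

Lemma rank_le1_line (U : {vspace V}) :
  (\dim U <= 1)%N -> exists l, forall u, u \in U -> exists a, u = a *: l.
Proof.
move=> dimU; exists (vpick U) => u uU; apply/vlineP.
suff /eqP-> : <[vpick U]>%VS == U by [].
rewrite eqEdim -memvE memv_pick dim_vline vpick0 -dimv_eq0 /=.
by case: (\dim U) dimU => [|[]].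
Qed.

(** Linear forms are polynomials, and polynomials have no zero divisors; here
    it is enough to evaluate at b, which makes b and c orthogonal, and then at
    b + c. *)
Lemma mul_forms_eq0 (b c : V) :
  (forall w, ip w b * ip w c = 0) -> b = 0 \/ c = 0.
Proof.
move=> H.
have [->|b0] := eqVneq b 0; first by left.
have bb : ip b b != 0 by rewrite ip_eq0.
right; apply/eqP; rewrite -ip_eq0.
have /eqP := H b; rewrite mulf_eq0 (negPf bb) /= => /eqP bc.
have /eqP := H (b + c); rewrite !ipE (ipC c b) bc addr0 add0r mulf_eq0.
by rewrite (negPf bb).
Qed.

Lemma mul_bilinear_eq0 B C :
  (forall v w, ip w (B v) * ip w (C v) = 0) -> B = 0 \/ C = 0.
Proof.
move=> H.
have H1 v : B v = 0 \/ C v = 0 by apply: mul_forms_eq0 => w; exact: H.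
have [->|/lfunPn[x]] := eqVneq B 0; first by left.
have [->|/lfunPn[y]] := eqVneq C 0; first by right.
rewrite !zero_lfunE => Cy Bx.
have Cx : C x = 0 by case: (H1 x) Bx => // ->; rewrite eqxx.
have By : B y = 0 by case: (H1 y) Cy => // ->; rewrite eqxx.
case: (H1 (x + y)); rewrite linearD /=.
  by rewrite By addr0 => Bx0; rewrite Bx0 eqxx in Bx.
by rewrite Cx add0r => Cy0; rewrite Cy0 eqxx in Cy.
Qed.

(** * Algebraic curvature tensors *)

Implicit Type (Rm : V -> V -> V -> V).

Definition skew A := forall x y, ip (A x) y = - ip x (A y).

Definition model_tensor kappa c A x y z : V :=
  kappa *: tensor1 ip x y z + c *: tensorA ip A x y z.

Lemma model_tensor_curvature kappa c A :
  skew A -> algebraic_curvature_tensor ip (model_tensor kappa c A).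
Proof.
move=> skA.
have H u v : ip u (A v) = - ip v (A u) by rewrite -skA ipC.
split.
- split=> [y z|x z|x y] a u v; apply: ip_inj => w;
  rewrite /model_tensor /tensor1 /tensorA ?mapE !ipE; ring.
- by move=> x y z w; rewrite /model_tensor /tensor1 /tensorA !ipE (H y x); ring.
- move=> x y z w; rewrite /model_tensor /tensor1 /tensorA !ipE !skA.
  rewrite (ipC w x) (ipC z x) (ipC z y) (ipC w y).
  by rewrite (H z x) (H w y) (H w x) (H z y); ring.
- move=> x y z; apply: ip_inj => w; rewrite /model_tensor /tensor1 /tensorA !ipE.
  by rewrite (H y x) (H z x) (H z y) (ipC y x) (ipC z x) (ipC z y); ring.
Qed.

Lemma linear_add (f : V -> V) : linear f -> {morph f : u v / u + v}.
Proof. by move=> lf u v; rewrite -[u]scale1r lf !scale1r. Qed.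

Lemma linear_scale (f : V -> V) a : linear f -> {morph f : u / a *: u}.
Proof.
move=> lf u; have f0 : f 0 = 0.
  by have := lf (-1) 0 0; rewrite scaler0 addr0 scaleN1r addNr.
by rewrite -[a *: u]addr0 lf f0 addr0.
Qed.

Lemma trilinearE Rm : trilinear Rm ->
  ((forall x x' y z, Rm (x + x') y z = Rm x y z + Rm x' y z) *
   (forall x y y' z, Rm x (y + y') z = Rm x y z + Rm x y' z) *
   (forall x y z z', Rm x y (z + z') = Rm x y z + Rm x y z')) *
  ((forall a x y z, Rm (a *: x) y z = a *: Rm x y z) *
   (forall a x y z, Rm x (a *: y) z = a *: Rm x y z) *
   (forall a x y z, Rm x y (a *: z) = a *: Rm x y z)) *
  ((forall x y z, Rm (- x) y z = - Rm x y z) *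
   (forall x y z, Rm x (- y) z = - Rm x y z) *
   (forall x y z, Rm x y (- z) = - Rm x y z)).
Proof.
move=> [l1 l2 l3].
have Z1 a x y z : Rm (a *: x) y z = a *: Rm x y z := linear_scale a (l1 y z) x.
have Z2 a x y z : Rm x (a *: y) z = a *: Rm x y z := linear_scale a (l2 x z) y.
have Z3 a x y z : Rm x y (a *: z) = a *: Rm x y z := linear_scale a (l3 x y) z.
have D1 x x' y z : Rm (x + x') y z = Rm x y z + Rm x' y z :=
  linear_add (l1 y z) x x'.
have D2 x y y' z : Rm x (y + y') z = Rm x y z + Rm x y' z :=
  linear_add (l2 x z) y y'.
have D3 x y z z' : Rm x y (z + z') = Rm x y z + Rm x y z' :=
  linear_add (l3 x y) z z'.
by do ![split] => //; move=> *; rewrite -scaleN1r (Z1, Z2, Z3) scaleN1r.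
Qed.

Lemma curvature_lincomb a b Rm1 Rm2 :
  algebraic_curvature_tensor ip Rm1 -> algebraic_curvature_tensor ip Rm2 ->
  algebraic_curvature_tensor ip (fun x y z => a *: Rm1 x y z + b *: Rm2 x y z).
Proof.
move=> [[l1 l2 l3] sk1 pr1 bi1] [[m1 m2 m3] sk2 pr2 bi2]; split.
- by split=> [y z|x z|x y] k u v;
    rewrite ?(l1, l2, l3) ?(m1, m2, m3); apply: ip_inj => w; rewrite !ipE; ring.
- by move=> x y z w; rewrite !ipE sk1 sk2; ring.
- by move=> x y z w; rewrite !ipE pr1 pr2.
- move=> x y z; have := congr1 (fun u => a *: u) (bi1 x y z).
  have := congr1 (fun u => b *: u) (bi2 x y z) => /= e2 e1.
  apply: ip_inj => w; have := congr1 (ip ^~ w) e1; have := congr1 (ip ^~ w) e2.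
  by rewrite !scaler0 !ipE => E1 E2; rewrite -[RHS]addr0 -{1}E1 -E2; ring.
Qed.

Lemma curvature_skew34 Rm : algebraic_curvature_tensor ip Rm ->
  forall x y z w, ip (Rm x y z) w = - ip (Rm x y w) z.
Proof. by move=> [_ sk pr _] x y z w; rewrite pr sk pr. Qed.

Lemma curvature_jacobi_sym Rm : algebraic_curvature_tensor ip Rm ->
  forall v x y, ip (Rm x v v) y = ip (Rm y v v) x.
Proof.
move=> cR v x y; have [_ sk pr _] := cR.
by rewrite pr sk (curvature_skew34 cR) opprK.
Qed.

(** Polarizing R(x,y,y,x) = 0 in x and then in y makes R skew in its first
    three arguments, so the three terms of the Bianchi identity coincide. *)
Lemma curvature_eq0 Rm : algebraic_curvature_tensor ip Rm ->
  (forall x y, ip (Rm x y y) x = 0) -> forall x y z, Rm x y z = 0.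
Proof.
move=> cR sec; have [tl sk pr bi] := cR; have mE := trilinearE tl.
have jac x y w : ip (Rm x y y) w = 0.
  have := sec (x + w) y; rewrite mE !ipE !sec.
  rewrite (curvature_jacobi_sym cR y w x); lra.
have sk2 x y z w : ip (Rm x y z) w = - ip (Rm x z y) w.
  have := jac x (y + z) w; rewrite !mE !ipE !jac; lra.
move=> x y z; apply: ip_inj => w; rewrite ip0l.
have := congr1 (ip ^~ w) (bi x y z) => /=; rewrite !ipE.
have -> : ip (Rm y z x) w = ip (Rm x y z) w by rewrite sk2 sk opprK.
have -> : ip (Rm z x y) w = ip (Rm x y z) w by rewrite sk sk2 opprK.
lra.
Qed.

Lemma curvature_ext Rm1 Rm2 :
  algebraic_curvature_tensor ip Rm1 -> algebraic_curvature_tensor ip Rm2 ->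
  (forall x y, ip (Rm1 x y y) x = ip (Rm2 x y y) x) ->
  forall x y z, Rm1 x y z = Rm2 x y z.
Proof.
move=> c1 c2 e x y z; apply/eqP; rewrite -subr_eq0; apply/eqP.
have := curvature_eq0 (curvature_lincomb 1 (-1) c1 c2).
move=> /(_ _ x y z) /=; rewrite scaleN1r scale1r; apply.
by move=> {}x {}y; rewrite !ipE e; ring.
Qed.

(** * Almost isotropic tensors *)

(** The rank bound is only given on the orthogonal complement of a unit vector.
    The operator w |-> D w is homogeneous in v and kills v, so the bound holds
    on the whole space and for every v; a symmetric operator whose image lies on
    a line has vanishing minors. *)
Lemma almost_isotropic_minor kappa Rm :
  algebraic_curvature_tensor ip Rm -> almost_isotropic ip kappa Rm ->
  forall v w1 w2,
    let D w := Rm w v v - kappa *: tensor1 ip w v v in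
    ip (D w1) w1 * ip (D w2) w2 = ip (D w1) w2 ^+ 2.
Proof.
move=> cR ai v w1 w2 D.
have [tl sk pr bi] := cR; have mE := trilinearE tl.
have Dsym w w' : ip (D w) w' = ip (D w') w.
  rewrite /D !ipE (curvature_jacobi_sym cR v w).
  by rewrite (ipC w w') (ipC v w) (ipC v w'); ring.
suff [l Dl] : exists l, forall w, exists a, D w = a *: l.
  rewrite expr2 {2}(Dsym w1 w2).
  have [a1 ->] := Dl w1; have [a2 ->] := Dl w2.
  by rewrite !ipE; ring.
have [v0|v0] := eqVneq v 0.
  exists 0 => w; exists 0; rewrite /D /tensor1 v0 !ip0r.
  have := mE.1.2.2 0 w 0 0; rewrite !scale0r => ->.
  by rewrite subr0 scaler0 subr0.
pose n := Num.sqrt (ip v v).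
have vv : 0 < ip v v by rewrite (@neq0_dnorm_gt0 _ _ _ ip).
have n0 : n != 0 by rewrite sqrtr_eq0 -ltNge.
have nn : n ^+ 2 = ip v v by rewrite sqr_sqrtr // ltW.
pose e := n^-1 *: v.
have ve : v = n *: e by rewrite scalerA divff // scale1r.
have ee : ip e e = 1 by rewrite !ipE -nn; field.
clearbody e.
have [l Hl] := rank_le1_line (ai e ee).
exists l => w.
have : w - ip w e *: e \in orthov ip <[e]>%VS.
  by rewrite mem_orthov_line !ipE ee mulr1 subrr.
move=> /(memv_img (jacobi Rm e - kappa *: \1)%VF) /Hl [a Ha].
exists (n ^+ 2 * a); rewrite -scalerA -Ha.
rewrite add_lfunE opp_lfunE scale_lfunE id_lfunE /jacobi linfunE; last first.
  by case: tl => l1 _ _; exact: l1.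
have Ree u : Rm e e u = 0.
  by apply: ip_inj => u'; have := sk e e u u'; rewrite ip0l; lra.
rewrite /D /tensor1 [in LHS]ve !mE !ipE !ee Ree.
by apply: ip_inj => u; rewrite !ipE; ring.
Qed.

Lemma skew0 : skew 0.
Proof. by move=> x y; rewrite !zero_lfunE ip0l ip0r oppr0. Qed.

Lemma skewP A : (forall v, ip (A v) v = 0) -> skew A.
Proof.
move=> alt x y; have := alt (x + y).
by rewrite mapE !ipE !alt (ipC (A y)); lra.
Qed.

Lemma tensorA0 x y z : tensorA ip 0 x y z = 0.
Proof. by rewrite /tensorA !zero_lfunE !scaler0 addr0 subr0. Qed.

Lemma tensor1_curvature : algebraic_curvature_tensor ip (tensor1 ip).
Proof.
have -> : tensor1 ip = model_tensor 1 0 0.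
  by do 3 apply/funext => ?; rewrite /model_tensor scale1r scale0r addr0.
exact: model_tensor_curvature skew0.
Qed.

Lemma tensorA_curvature A : skew A -> algebraic_curvature_tensor ip (tensorA ip A).
Proof.
move=> skA; have -> : tensorA ip A = model_tensor 0 1 A.
  by do 3 apply/funext => ?; rewrite /model_tensor scale1r scale0r add0r.
exact: model_tensor_curvature.
Qed.

Lemma sect_tensorA A : skew A ->
  forall x y, ip (tensorA ip A x y y) x = 3 * ip (A y) x ^+ 2.
Proof.
move=> skA x y; rewrite /tensorA !ipE (ipC x (A y)) (_ : ip y (A y) = 0); last first.
  by have := skA y y; rewrite (ipC y); lra.
ring.
Qed.

(** The form q_v(w) = <D(w,v)v,w> is quadratic in v, of rank at most 1 in w,
    and symmetric under exchange of v and w; this makes it a constant times the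
    square of a bilinear form <Av,w>.  The map A is obtained by dividing the
    quadratic map v |-> D(w0,v)v by the linear form lam, on whose kernel it
    vanishes. *)
Lemma rank_one_curvature D : algebraic_curvature_tensor ip D ->
  (forall v w1 w2,
     ip (D w1 v v) w1 * ip (D w2 v v) w2 = ip (D w1 v v) w2 ^+ 2) ->
  exists c A, skew A /\ forall x y z, D x y z = c *: tensorA ip A x y z.
Proof.
move=> cD minor.
have [tl sk pr bi] := cD; have mE := trilinearE tl.
have [D0|] := pselect (forall x y, ip (D x y y) x = 0).
  exists 0, 0; split=> [|x y z]; first exact: skew0.
  by rewrite (curvature_eq0 cD D0) scale0r.
move=> /existsNP [u /existsNP [w0 /eqP s0]].
set s := ip (D u w0 w0) u in s0.
pose lam v := ip (D u w0 w0) v / s.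
have lamD v v' : lam (v + v') = lam v + lam v' by rewrite /lam ipE mulrDl.
have lamZ a v : lam (a *: v) = a * lam v by rewrite /lam ipE mulrA.
have lamu : lam u = 1 by rewrite /lam divff.
have sec_w0 v : ip (D w0 v v) w0 = s * lam v ^+ 2.
  rewrite sk (curvature_skew34 cD) opprK.
  apply: (mulfI s0); rewrite minor /lam; by field.
pose f v := D w0 u v + D w0 v u - lam v *: D w0 u u.
have lin_f : linear f.
  by move=> a v v'; apply: ip_inj => w; rewrite /f !mE lamD lamZ !ipE; ring.
pose A := linfun f.
have AE v : A v = D w0 u v + D w0 v u - lam v *: D w0 u u by exact: linfunE.
(* The minor condition kills the mixed term on ker lam; f is the quotient of
   that term by lam, computed on the splitting of v along ker lam and u. *)
have mix v w : ip (D w0 v v) w = lam v * ip (A v) w.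
  have : lam (v + (- lam v) *: u) = 0 by rewrite lamD lamZ lamu; ring.
  set v' := v + _ => lam_v'.
  have /eqP := minor v' w0 w.
  rewrite sec_w0 lam_v' expr0n mulr0 mul0r eq_sym sqrf_eq0 => /eqP.
  by rewrite /v' !mE AE !ipE => e; lra.
have sec v w : s * ip (D w v v) w = ip (A v) w ^+ 2.
  (* G is quadratic in v and vanishes off the hyperplane lam = 0, so it vanishes
     there as well by the parallelogram identity at v + u and v - u. *)
  pose G v := s * ip (D w v v) w - ip (A v) w ^+ 2.
  have G0 x : lam x != 0 -> G x = 0.
    move=> lx; apply/eqP; rewrite -(mulrI_eq0 _ (mulfI (expf_neq0 2 lx))) /G.
    by have := minor x w0 w; rewrite sec_w0 mix => e; apply/eqP; lra.
  suff : G v = 0 by rewrite /G; lra.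
  have [lv|] := eqVneq (lam v) 0; last exact: G0.
  have Gp : G (v + u) = 0 by apply: G0; rewrite lamD lv lamu add0r oner_eq0.
  have Gm : G (v - u) = 0.
    by apply: G0; rewrite lamD -scaleN1r lamZ lv lamu add0r mulr1 oppr_eq0 oner_eq0.
  have Gu : G u = 0 by apply: G0; rewrite lamu oner_eq0.
  suff : G (v + u) + G (v - u) = 2 * G v + 2 * G u by rewrite Gp Gm Gu; lra.
  by rewrite /G !mapE !mE !ipE; ring.
have skA : skew A.
  apply: skewP => v; apply/eqP; rewrite -sqrf_eq0 -sec.
  suff -> : ip (D v v v) v = 0 by rewrite mulr0.
  by have := sk v v v v; lra.
(* The form <R_A(w,v)v,w> is 3 <Av,w>^2, whence the factor 3. *)
exists (3 * s)^-1, A; split=> //.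
have cD' := curvature_lincomb (3 * s)^-1 0 (tensorA_curvature skA) cD.
move=> x y z; rewrite (curvature_ext cD cD') ?scale0r ?addr0 // => {}x {}y.
rewrite scale0r addr0 ipE (sect_tensorA skA) -sec.
by field.
Qed.

Lemma almost_isotropic_model kappa Rm :
  algebraic_curvature_tensor ip Rm -> almost_isotropic ip kappa Rm ->
  exists c A, skew A /\ forall x y z, Rm x y z = model_tensor kappa c A x y z.
Proof.
move=> cR ai.
have := curvature_lincomb 1 (- kappa) cR tensor1_curvature.
set D := fun x y z => _; move=> cD.
have DE w v : D w v v = Rm w v v - kappa *: tensor1 ip w v v.
  by rewrite /D scale1r scaleNr.
have [v w1 w2|c [A [skA HA]]] := rank_one_curvature cD.
  by rewrite !DE; exact: (almost_isotropic_minor cR ai v w1 w2).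
exists c, A; split=> // x y z.
by rewrite /model_tensor -HA /D scale1r scaleNr addrC subrK.
Qed.

Lemma model_almost_isotropic kappa c A :
  skew A -> almost_isotropic ip kappa (model_tensor kappa c A).
Proof.
move=> skA v vv.
have [[l1 _ _] _ _ _] := model_tensor_curvature kappa c skA.
apply: (@leq_trans (\dim <[A v]>)); last by rewrite dim_vline leq_b1.
apply/dimvS/subvP => _ /memv_imgP[w + ->]; rewrite mem_orthov_line => /eqP wv.
rewrite add_lfunE opp_lfunE scale_lfunE id_lfunE /jacobi linfunE //.
apply/vlineP; exists (3 * c * ip w (A v)).
have vAv : ip v (A v) = 0 by have := skA v v; rewrite (ipC v); lra.
apply: ip_inj => x.
by rewrite /model_tensor /tensor1 /tensorA !ipE vv wv vAv; ring.
Qed.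

(** * The Kahler condition *)

Variable J : 'End(V).
Hypothesis acs : almost_complex_structure ip J.
Implicit Type S : 'End(V).

Lemma JJ x : J (J x) = - x.
Proof. by have /lfunP/(_ x) := acs.2; rewrite comp_lfunE opp_lfunE id_lfunE. Qed.

Lemma ipJJ x y : ip (J x) (J y) = ip x y.
Proof. exact: acs.1. Qed.

Lemma skewJ : skew J.
Proof. by move=> x y; rewrite -ipJJ JJ ipNl. Qed.

Lemma ipxJx x : ip x (J x) = 0.
Proof. by have := skewJ x x; rewrite (ipC _ (J x)); lra. Qed.

Lemma ipJxx x : ip (J x) x = 0.
Proof. by rewrite ipC ipxJx. Qed.

(** These are the Hermitian endomorphisms of V seen as a complex vector space. *)
Definition complex_symmetric S :=
  (forall x y, ip (S x) y = ip x (S y)) /\ (forall x, S (J x) = J (S x)).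

(** Sectional curvature of a Kahler tensor is J-invariant, so <Av,w>^2 is; by
    [mul_bilinear_eq0] the sign of <AJv,Jw> relative to <Av,w> is the same for
    all v and w, so A commutes or anticommutes with J. *)
Lemma kahler_skew_commute kappa c A : skew A -> c != 0 ->
  kahler J (model_tensor kappa c A) -> forall x, A (J x) = J (A x).
Proof.
move=> skA c0 kal.
have skAr x y : ip x (A y) = - ip y (A x) by rewrite (ipC y) skA opprK.
have ipxAx x : ip x (A x) = 0 by have := skAr x x; lra.
have sq v w : ip w (A v) ^+ 2 = ip (J w) (A (J v)) ^+ 2.
  pose sec x y := ip (model_tensor kappa c A x y y) x.
  have secE x y : sec x y =
      kappa * (ip x x * ip y y - ip x y ^+ 2) + 3 * c * ip x (A y) ^+ 2.
    by rewrite /sec ipDl !ipZl (sect_tensorA skA) !ipE (ipC y x) (ipC (A y)); ring.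
  have : sec w v = sec (J w) (J v).
    have cM := model_tensor_curvature kappa c skA.
    have [_ sk pr _] := cM.
    by rewrite /sec kal pr kal sk (curvature_skew34 cM) opprK.
  by rewrite !secE !ipJJ => /(addrI _) /(mulfI _) -> //; rewrite mulf_neq0 ?pnatr_eq0.
have [B0|C0] : A - (J \o A \o J)%VF = 0 \/ A + (J \o A \o J)%VF = 0.
- apply: mul_bilinear_eq0 => v w.
  rewrite !add_lfunE opp_lfunE !comp_lfunE !ipE.
  have -> : ip w (J (A (J v))) = - ip (J w) (A (J v)) by rewrite skewJ opprK.
  by have := sq v w => e; rewrite -[RHS](subrr (ip w (A v) ^+ 2)) {2}e; ring.
- (* If A anticommutes with J, the identity E at y = Ax and at y = JAx gives
     two relations between kappa |x|^2 |Ax|^2 and c |Ax|^4, with different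
     coefficients, so Ax = 0. *)
  have AJ x : A (J x) = - J (A x).
    have /lfunP/(_ (J x)) := B0; rewrite zero_lfunE add_lfunE opp_lfunE !comp_lfunE.
    by rewrite JJ !mapE => /eqP; rewrite opprK addr_eq0 => /eqP.
  suff A0 x : A x = 0 by move=> x; rewrite !A0 linear0.
  have ipJA y z : ip (J (A y)) z = - ip y (J (A z)).
    by rewrite skewJ skA AJ !ipE opprK.
  have ipxJA y : ip y (J (A y)) = 0 by have := ipJA y y; rewrite (ipC _ y); lra.
  have E y : kappa * (ip x x * ip y y - ip x y ^+ 2 - ip (J x) y ^+ 2)
      + c * (5 * ip x (A y) ^+ 2 - ip (J (A x)) y ^+ 2) = 0.
    have /(congr1 (fun u => ip u x)) := kal x y y.
    rewrite /model_tensor /tensor1 /tensorA !ipE !AJ !ipE !ipJJ.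
    rewrite (ipC y x) (ipC (A y) x) !ipxAx !ipJxx (skewJ y x) (skewJ y (A y)) ipxJA.
    rewrite (skewJ x (A y)) (ipC x (J _)) (ipJA y x) (ipC y (J _)) (ipC y (J _)).
    by lra.
  have E1 := E (A x); have E2 := E (J (A x)).
  move: E1 E2; rewrite !ipxAx !ipJJ !ipxAx (skewJ x (A x)) ipxJA ipJxx.
  rewrite (skAr x (A x)).
  have -> : ip x (A (J (A x))) = 0 by rewrite skAr ipJxx oppr0.
  move=> E1 E2; have : c * ip (A x) (A x) ^+ 2 = 0 by lra.
  by move=> /eqP; rewrite mulf_eq0 (negPf c0) sqrf_eq0 ip_eq0 => /eqP.
- move=> x; have /lfunP/(_ (J x)) := C0.
  rewrite zero_lfunE add_lfunE !comp_lfunE JJ !mapE => /eqP.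
  by rewrite subr_eq0 => /eqP.
Qed.

(** The part of R_1 that prevents it from being Kahler. *)
Definition J_defect x y z : V := tensor1 ip x y z - tensor1 ip (J x) (J y) z.

Definition balanced kappa c S :=
  forall x y z, kappa *: J_defect x y z = c *: J_defect (S x) (S y) z.

Lemma complex_symmetric_skew S : complex_symmetric S -> skew (J \o S)%VF.
Proof. by move=> [sS cS] x y; rewrite !comp_lfunE skewJ sS cS. Qed.

(** With A = JS, the terms of R_A(x,y) - R_A(Jx,Jy) that contain <x,Ay> cancel;
    the others are those of R_1 evaluated at Sx and Sy, with a sign. *)
Lemma model_tensor_defect kappa c S : complex_symmetric S ->
  forall x y z,
    model_tensor kappa c (J \o S)%VF x y z
      - model_tensor kappa c (J \o S)%VF (J x) (J y) z
    = kappa *: J_defect x y z - c *: J_defect (S x) (S y) z.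
Proof.
move=> [sS cS] x y z; apply: ip_inj => w.
rewrite /model_tensor /J_defect /tensor1 /tensorA !comp_lfunE !cS !JJ.
rewrite !ipE. rewrite !(skewJ (S _) z) !(sS _ z) !(sS _ (J z)) !cS.
by rewrite (skewJ x (S y)) !ipJJ; ring.
Qed.

(** This reduces the classification to the pairs of a constant c and a Hermitian
    S that satisfy [balanced]. *)
Lemma kahler_almost_isotropicP kappa Rm :
  kahler_almost_isotropic ip J kappa Rm <->
  exists c S, [/\ complex_symmetric S, balanced kappa c S &
    forall x y z, Rm x y z = model_tensor kappa c (J \o S)%VF x y z].
Proof.
split=> [[cR kal ai]|[c [S [symS bal E]]]].
- have [c [A [skA RE]]] := almost_isotropic_model cR ai.
  suff [c' [S [symS E]]] : exists c' S, complex_symmetric S /\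
      forall x y z, Rm x y z = model_tensor kappa c' (J \o S)%VF x y z.
    exists c', S; split=> // x y z; apply/eqP; rewrite -subr_eq0.
    by rewrite -model_tensor_defect // -!E -kal subrr.
  have [c0|c0] := eqVneq c 0.
    exists 0, 0; split=> [|x y z].
      by split=> [x y|x]; rewrite !zero_lfunE ?ipE ?linear0.
    by rewrite RE c0 /model_tensor !scale0r.
  have comAJ : forall x, A (J x) = J (A x).
    apply: (kahler_skew_commute (kappa := kappa) skA c0) => x y z.
    by rewrite -!RE.
  exists c, (- (J \o A))%VF; split.
    split=> [x y|x]; rewrite !opp_lfunE !comp_lfunE ?comAJ ?mapE //.
    by rewrite !ipE skewJ skA comAJ opprK.
  move=> x y z; rewrite RE; congr (model_tensor _ _ _ x y z); apply/lfunP => u.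
  by rewrite comp_lfunE opp_lfunE comp_lfunE mapE JJ opprK.
- have -> : Rm = model_tensor kappa c (J \o S)%VF by do 3 apply/funext => ?.
  have skA := complex_symmetric_skew symS.
  split; [exact: model_tensor_curvature| |exact: model_almost_isotropic].
  move=> x y z; apply/eqP; rewrite -subr_eq0 model_tensor_defect //.
  by rewrite bal subrr.
Qed.

(** * Orthogonal projections and holomorphic planes *)

Lemma exists_orthogonal (s : seq V) : (size s < \dim {:V})%N ->
  exists2 y, y != 0 & forall x, x \in s -> ip y x = 0.
Proof.
suff [U dimU HU] : exists2 U : {vspace V}, (\dim {:V} <= \dim U + size s)%N &
    forall y x, y \in U -> x \in s -> ip y x = 0.
  move=> lt_s; exists (vpick U); last by move=> x; apply: HU; exact: memv_pick.
  rewrite vpick0 -dimv_eq0 -lt0n -(ltn_add2r (size s)) add0n.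
  exact: leq_trans lt_s dimU.
elim: s => [|a s [U dimU HU]]; first by exists fullv; rewrite ?addn0.
exists (U :&: orthov ip <[a]>)%VS.
  rewrite /= addnS -addSn (leq_trans dimU) // leq_add2r.
  by apply: leq_trans (leqSpred _) _; rewrite ltnS; exact: leq_dim_orthov1.
move=> y x; rewrite memv_cap mem_orthov_line => /andP[yU /eqP ya].
by rewrite inE => /predU1P[->|/(HU _ _ yU)].
Qed.

Lemma orthov_disjoint W : (W :&: orthov ip W = 0)%VS.
Proof.
apply/eqP; rewrite -subv0; apply/subvP => u; rewrite memv_cap memv0.
by move=> /andP[uW /mem_orthov /(_ _ uW) /eqP]; rewrite ip_eq0.
Qed.

Lemma dim_orthov W : (\dim W + \dim (orthov ip W) = \dim {:V})%N.
Proof.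
apply/eqP; rewrite -dimv_disjoint_sum ?orthov_disjoint // eqn_leq dimvS ?subvf //= leqNgt.
apply/negP => lt.
pose B := vbasis (W + orthov ip W).
have [|y y0 Hy] := @exists_orthogonal B; first by rewrite size_tuple.
have sub : (W + orthov ip W <= orthov ip <[y]>)%VS.
  rewrite -(span_basis (vbasisP (W + orthov ip W)%VS)); apply/span_subvP => x xB.
  by rewrite mem_orthov_line ipC Hy.
have ipy x : x \in (W + orthov ip W)%VS -> ip y x = 0.
  by move=> /(subvP sub); rewrite mem_orthov_line ipC => /eqP.
have yW : y \in orthov ip W.
  by apply/mem_orthov => x xW; apply: ipy; exact: (subvP (addvSl _ _)).
by move: y0; rewrite -ip_eq0 ipy ?eqxx // (subvP (addvSr _ _)).
Qed.

Lemma orthov_sum W : (W + orthov ip W = fullv)%VS.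
Proof.
apply/eqP; rewrite eqEdim subvf /= dimv_disjoint_sum ?orthov_disjoint //.
by rewrite dim_orthov.
Qed.

Lemma orthoproj_mem W x : orthoproj ip W x \in W.
Proof. exact: memv_pi. Qed.

Lemma orthoproj_orthov W x : x - orthoproj ip W x \in orthov ip W.
Proof.
have {1}<- := daddv_pi_add (orthov_disjoint W) (_ : x \in (W + _)%VS).
  by rewrite addrC addKr memv_pi.
by rewrite orthov_sum memvf.
Qed.

Lemma orthoproj_unique W x u :
  u \in W -> x - u \in orthov ip W -> orthoproj ip W x = u.
Proof.
move=> uW xu; apply/eqP; rewrite -subr_eq0 -memv0 -(orthov_disjoint W) memv_cap.
rewrite rpredB ?orthoproj_mem //=.
have -> : orthoproj ip W x - u = (x - u) - (x - orthoproj ip W x).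
  by rewrite opprB [RHS]addrC addrA subrK.
by rewrite rpredB ?orthoproj_orthov.
Qed.

Lemma orthoproj_sym W x y : ip (orthoproj ip W x) y = ip x (orthoproj ip W y).
Proof.
have H u v : ip (orthoproj ip W u) v = ip (orthoproj ip W u) (orthoproj ip W v).
  have /mem_orthov/(_ _ (orthoproj_mem W u)) := orthoproj_orthov W v.
  by rewrite ipC !ipE => e; lra.
by rewrite H ipC -H ipC.
Qed.

Lemma orthoproj_J W : (J @: W <= W)%VS ->
  forall x, orthoproj ip W (J x) = J (orthoproj ip W x).
Proof.
move=> JW x.
have JWx y : y \in W -> J y \in W by move=> yW; rewrite (subvP JW) ?memv_img.
apply: orthoproj_unique; first by rewrite JWx ?orthoproj_mem.
apply/mem_orthov => y yW; have /mem_orthov := orthoproj_orthov W x.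
by move=> /(_ _ (JWx y yW)); rewrite !ipE !skewJ => e; lra.
Qed.

Lemma orthoproj_complex_symmetric W : (J @: W <= W)%VS ->
  complex_symmetric (orthoproj ip W).
Proof. by move=> JW; split; [exact: orthoproj_sym|exact: orthoproj_J]. Qed.

(** The complex line through x, as a real subspace. *)
Definition hol_line x : {vspace V} := (<[x]> + <[J x]>)%VS.

Lemma hol_lineP x u :
  reflect (exists a b, u = a *: x + b *: J x) (u \in hol_line x).
Proof.
apply: (iffP memv_addP) => [[_ /vlineP[a ->] [_ /vlineP[b ->] ->]]|[a [b ->]]].
  by exists a, b.
exists (a *: x); first by rewrite memvZ ?memv_line.
by exists (b *: J x); rewrite ?memvZ ?memv_line.
Qed.

Lemma mem_hol_line x : (x \in hol_line x) * (J x \in hol_line x).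
Proof.
split; apply/hol_lineP; first by exists 1, 0; rewrite scale1r scale0r addr0.
by exists 0, 1; rewrite scale1r scale0r add0r.
Qed.

Lemma mem_orthov_hol_line x u :
  (u \in orthov ip (hol_line x)) <-> (ip u x = 0 /\ ip u (J x) = 0).
Proof.
split=> [/mem_orthov H|[H1 H2]].
  by rewrite !H ?mem_hol_line.
by apply/mem_orthov => _ /hol_lineP[a [b ->]]; rewrite !ipE H1 H2 !mulr0 addr0.
Qed.

Lemma dim_hol_line x : x != 0 -> \dim (hol_line x) = 2%N.
Proof.
move=> x0; have Jx0 : J x != 0 by rewrite -ip_eq0 ipJJ ip_eq0.
rewrite dimv_disjoint_sum ?dim_vline ?x0 ?Jx0 //.
apply/eqP; rewrite -subv0; apply/subvP => u; rewrite memv_cap memv0.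
move=> /andP[/vlineP[a ->] /vlineP[b e]].
have /(congr1 (ip x)) := e; rewrite !ipE ipxJx mulr0 => /eqP.
by rewrite mulf_eq0 ip_eq0 (negPf x0) orbF => /eqP->; rewrite scale0r.
Qed.

Lemma holomorphic_hol_line x : x != 0 -> holomorphic_plane J (hol_line x).
Proof.
move=> x0; split; first exact: dim_hol_line.
apply/subvP => _ /memv_imgP[_ /hol_lineP[a [b ->]] ->]; apply/hol_lineP.
by exists (- b), a; rewrite !mapE JJ scalerN scaleNr addrC.
Qed.

Lemma holomorphic_planeE W x : holomorphic_plane J W -> x \in W -> x != 0 ->
  W = hol_line x.
Proof.
move=> [dimW JW] xW x0; apply/eqP; rewrite eq_sym eqEdim dimW dim_hol_line // leqnn andbT.
by rewrite subv_add -!memvE xW /= (subvP JW) ?memv_img.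
Qed.

(** On the complex line of x only R_1(x,Jx) matters, and R_1(x,Jx) equals
    R_1(Jx,JJx). *)
Lemma J_defect_hol_line x y z : y \in hol_line x -> J_defect x y z = 0.
Proof.
move=> /hol_lineP[a [b ->]]; apply: ip_inj => w.
by rewrite /J_defect /tensor1 !mapE !JJ !ipE; ring.
Qed.

Lemma J_defect_plane W x y z : holomorphic_plane J W -> x \in W -> y \in W ->
  J_defect x y z = 0.
Proof.
move=> hW xW yW; have [->|x0] := eqVneq x 0.
  by apply: ip_inj => w; rewrite /J_defect /tensor1 !mapE !ipE; ring.
by apply: J_defect_hol_line; rewrite -(holomorphic_planeE hW xW x0).
Qed.

Lemma J_defectD x x' y y' z :
  J_defect (x + x') (y + y') z =
    J_defect x y z + J_defect x y' z + (J_defect x' y z + J_defect x' y' z).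
Proof. by apply: ip_inj => w; rewrite /J_defect /tensor1 !mapE !ipE; ring. Qed.

Lemma J_defectZ a b x y z : J_defect (a *: x) (b *: y) z = (a * b) *: J_defect x y z.
Proof. by apply: ip_inj => w; rewrite /J_defect /tensor1 !mapE !ipE; ring. Qed.

Lemma tensorA_scale a A x y z : tensorA ip (a *: A) x y z = a ^+ 2 *: tensorA ip A x y z.
Proof. by apply: ip_inj => w; rewrite /tensorA !scale_lfunE !ipE; ring. Qed.

(** * Hermitian solutions of the balance identity *)

Lemma complex_symmetric_ipJ S x : complex_symmetric S -> ip (S x) (J x) = 0.
Proof.
move=> [sS cS]; have := sS x (J x); rewrite cS.
by have := skewJ x (S x); rewrite ipC; lra.
Qed.

(** The balance identity at (x,y) applied to x, for y in the complement of the
    complex line of x: in this form it locates S y. *)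
Lemma balanced_orth kappa c S x y : complex_symmetric S -> balanced kappa c S ->
  ip y x = 0 -> ip y (J x) = 0 ->
  (kappa * ip x x) *: y
  = c *: (ip (S x) x *: S y - ip (S y) x *: S x + ip (J (S y)) x *: J (S x)).
Proof.
move=> symS bal yx yJx; have JSx : ip (J (S x)) x = 0.
  by rewrite skewJ (complex_symmetric_ipJ _ symS) oppr0.
have e := bal x y x; apply: ip_inj => w; move: (congr1 (ip ^~ w) e).
rewrite /J_defect /tensor1 !ipE yx JSx ipJxx skewJ yJx => e'; lra.
Qed.

Lemma eigen_hol_line S x l : complex_symmetric S -> S x = l *: x ->
  forall v, v \in hol_line x -> S v = l *: v.
Proof.
move=> [_ cS] Sx _ /hol_lineP[p [q ->]]; rewrite !mapE cS Sx !mapE scalerDr.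
by rewrite !scalerA ![l * _]mulrC.
Qed.

(** For kappa = 0 the balance identity at (x0,y) applied to u = S x0 puts every
    S y on the complex line of u. *)
Lemma rank_one_complex_symmetric c S : complex_symmetric S -> c != 0 ->
  balanced 0 c S -> S != 0 ->
  exists a W, holomorphic_plane J W /\ S = a *: orthoproj ip W.
Proof.
move=> symS c0 bal /lfunPn[x0]; rewrite zero_lfunE => u0.
have [sS cS] := symS.
set u := S x0 in u0 *.
have uu : ip u u != 0 by rewrite ip_eq0.
have Sim y : S y \in hol_line u.
  have /eqP := bal x0 y u; rewrite scale0r eq_sym scaler_eq0 (negPf c0) /= => /eqP.
  rewrite /J_defect /tensor1 -/u => e.
  apply/hol_lineP; exists ((ip u u)^-1 * ip (S y) u), (- ((ip u u)^-1 * ip (J (S y)) u)).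
  apply: ip_inj => w; have := congr1 (ip ^~ w) e; rewrite !ipE ipJxx => e'.
  have uuSy : ip u u * ip (S y) w = ip (S y) u * ip u w - ip (J (S y)) u * ip (J u) w.
    lra.
  by rewrite -[LHS](mulKf uu) uuSy; ring.
have [a Su] : exists a, S u = a *: u.
  have /hol_lineP[a [b e]] := Sim u; exists a.
  have := complex_symmetric_ipJ u symS.
  rewrite e !ipE ipJJ ipxJx mulr0 add0r => /eqP.
  by rewrite mulf_eq0 (negPf uu) orbF => /eqP->; rewrite scale0r addr0.
have SW := eigen_hol_line symS Su.
exists a, (hol_line u); split; first exact: holomorphic_hol_line.
apply/lfunP => x; rewrite scale_lfunE -SW ?orthoproj_mem //.
apply/eqP; rewrite -subr_eq0 -lfunN -lfunD -memv0 -(orthov_disjoint (hol_line u)).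
rewrite memv_cap Sim /=; apply/mem_orthov => v vW.
have /mem_orthov/(_ v vW) := orthoproj_orthov (hol_line u) x.
by rewrite sS (SW _ vW) ipZr => ->; rewrite mulr0.
Qed.

Lemma eigenvector_split kappa c S y l : complex_symmetric S ->
  balanced kappa c S -> y != 0 -> S y = l *: y ->
  forall z, z \in orthov ip (hol_line y) -> kappa *: z = (c * l) *: S z.
Proof.
move=> symS bal y0 Sy z /mem_orthov_hol_line[zy zJy].
have [sS cS] := symS; have yy : ip y y != 0 by rewrite ip_eq0.
have := balanced_orth symS bal zy zJy.
rewrite Sy skewJ !sS cS Sy !mapE !ipE zy zJy => e.
apply: ip_inj => w; have := congr1 (ip ^~ w) e; rewrite !ipE => e'.
by apply: (mulfI yy); lra.
Qed.

(** R_1 itself is not Kahler in dimension at least 4: its defect at two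
    orthogonal complex lines does not vanish. *)
Lemma balanced_neq0 kappa c S : (4 <= \dim {:V})%N -> kappa != 0 ->
  balanced kappa c S -> c != 0 /\ S != 0.
Proof.
move=> dimV k0 bal.
have [|x x0 _] := @exists_orthogonal [::]; first exact: leq_trans dimV.
have [|y y0 Hy] := @exists_orthogonal [:: x; J x]; first exact: leq_trans dimV.
have [yx yJx] : ip y x = 0 /\ ip y (J x) = 0.
  by split; apply: Hy; rewrite !inE eqxx ?orbT.
have xx : ip x x != 0 by rewrite ip_eq0.
have yy : ip y y != 0 by rewrite ip_eq0.
have : c *: J_defect (S x) (S y) x != 0.
  rewrite -bal /J_defect /tensor1 yx ipJxx skewJ yJx; apply/eqP.
  move=> /(congr1 (ip ^~ y)) /eqP; rewrite !ipE.
  rewrite oppr0 !mul0r subr0 add0r subr0 mulrN oppr_eq0.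
  by rewrite !mulf_eq0 (negPf k0) (negPf xx) (negPf yy).
move=> h; split; apply: contra_neq h => ->; first by rewrite scale0r.
by rewrite !zero_lfunE /J_defect /tensor1 !mapE !ipE; apply: ip_inj => w; rewrite !ipE; ring.
Qed.

(** Take x with <Sx,x> <> 0 and let z be the component of S x orthogonal to x.
    The balance identity shows that S z is a combination of x and z, so the real
    plane spanned by x and z is S-invariant, and the matrix of S there has a
    real eigenvalue.  The argument replaces the spectral theorem and is the same
    in all dimensions. *)
Lemma complex_symmetric_eigenvector kappa c S : c != 0 -> S != 0 ->
  complex_symmetric S -> balanced kappa c S ->
  exists y l, y != 0 /\ S y = l *: y.
Proof.
move=> c0 S0 symS bal; have [sS cS] := symS.
have [x xSx] : exists x, ip (S x) x != 0.
  apply: contrapT => /forallNP H; move: S0 => /lfunPn[x]; rewrite zero_lfunE => /eqP; apply.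
  have skS : skew S by apply: skewP => v; apply/eqP; apply: contrapT => /negP; exact: H.
  by apply: ip_inj => w; have := skS x w; rewrite -sS ip0l; lra.
have x0 : x != 0 by apply: contraNneq xSx => ->; rewrite mapE ip0l.
have xx : ip x x != 0 by rewrite ip_eq0.
pose a := ip (S x) x / ip x x.
have a0 : a != 0 by rewrite mulf_neq0 ?invr_eq0.
pose z := S x - a *: x.
have Sx : S x = a *: x + z by rewrite addrC subrK.
have zx : ip z x = 0 by rewrite /z !ipE /a divfK // subrr.
have zJx : ip z (J x) = 0 by rewrite /z !ipE complex_symmetric_ipJ // ipxJx; ring.
have [z0|z0] := eqVneq z 0; first by exists x, a; split=> //; rewrite Sx z0 addr0.
clearbody z a.
have zz : 0 < ip z z by rewrite (@neq0_dnorm_gt0 _ _ _ ip).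
have xx0 : 0 < ip x x by rewrite (@neq0_dnorm_gt0 _ _ _ ip).
pose n := ip z z / ip x x.
have n0 : 0 < n by rewrite divr_gt0.
pose d := (c * ip z z + kappa * ip x x) / (c * a * ip x x).
have Sz : S z = n *: x + d *: z.
  have := balanced_orth symS bal zx zJx.
  rewrite skewJ !sS cS Sx !mapE !ipE ipxJx zx zJx (ipC x z) zx => e.
  apply: ip_inj => w; have := congr1 (ip ^~ w) e; rewrite !ipE => e'.
  have h : c * a * ip x x != 0 by rewrite !mulf_neq0.
  apply: (mulfI h).
  have -> : c * a * ip x x * (n * ip x w + d * ip z w)
    = c * a * ip z z * ip x w + (c * ip z z + kappa * ip x x) * ip z w.
    by rewrite /n /d; field; rewrite a0 c0 xx.
  by lra.
(* Here S x = a x + z and S z = n x + d z, so the eigenvalues are the roots l of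
   (l - a) (l - d) = n, with eigenvector (l - d) x + z. *)
pose r := Num.sqrt ((a - d) ^+ 2 + 4 * n).
have rr : r ^+ 2 = (a - d) ^+ 2 + 4 * n.
  by rewrite sqr_sqrtr // addr_ge0 ?sqr_ge0 // mulr_ge0 // ltW.
pose l := (a + d + r) / 2.
exists ((l - d) *: x + z), l; split.
  apply: contraTneq zz => /(congr1 (ip ^~ z)).
  by rewrite !ipE (ipC x z) zx => e; rewrite -leNgt; lra.
have E : (l - d) * a + n = l * (l - d) by rewrite /l; lra.
rewrite !mapE Sx Sz; apply: ip_inj => w; rewrite !ipE.
transitivity (((l - d) * a + n) * ip x w + l * ip z w); first by ring.
by rewrite E; ring.
Qed.

Lemma balanced_eigenspaces kappa c S : (4 <= \dim {:V})%N -> kappa != 0 ->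
  complex_symmetric S -> balanced kappa c S ->
  exists y l m, [/\ y != 0, c * (l * m) = kappa, S y = l *: y &
    forall z, z \in orthov ip (hol_line y) -> S z = m *: z].
Proof.
move=> dimV k0 symS bal.
have [c0 S0] := balanced_neq0 dimV k0 bal.
have [y [l [y0 Sy]]] := complex_symmetric_eigenvector c0 S0 symS bal.
have H := eigenvector_split symS bal y0 Sy.
have [|z z0 Hz] := @exists_orthogonal [:: y; J y]; first exact: leq_trans dimV.
have zW : z \in orthov ip (hol_line y).
  by apply/mem_orthov_hol_line; split; apply: Hz; rewrite !inE eqxx ?orbT.
have cl0 : c * l != 0.
  apply: contra_neq z0 => cl; move: (H z zW); rewrite cl scale0r => /eqP.
  by rewrite scaler_eq0 (negPf k0) => /eqP.
exists y, l, (kappa / (c * l)); split=> //; first by rewrite mulrA mulrC divfK.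
by move=> x /H e; rewrite mulrC -scalerA e scalerA mulVf // scale1r.
Qed.

(** Two orthogonal complex lines, through x and z, in the complement of the one
    of y give c m^2 = kappa = c l m. *)
Lemma balanced_scalar kappa c S : (6 <= \dim {:V})%N -> kappa != 0 ->
  complex_symmetric S -> balanced kappa c S ->
  exists l, c * l ^+ 2 = kappa /\ S = l *: \1%VF.
Proof.
move=> dimV k0 symS bal.
have dim4 : (4 <= \dim {:V})%N by exact: leq_trans dimV.
have [y [l [m [y0 clm Sy Sz]]]] := balanced_eigenspaces dim4 k0 symS bal.
have [|x x0 Hx] := @exists_orthogonal [:: y; J y]; first exact: leq_trans dimV.
have [|z z0 Hz] := @exists_orthogonal [:: y; J y; x; J x]; first exact: leq_trans dimV.
have xW : x \in orthov ip (hol_line y).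
  by apply/mem_orthov_hol_line; split; apply: Hx; rewrite !inE eqxx ?orbT.
have zW : z \in orthov ip (hol_line y).
  by apply/mem_orthov_hol_line; split; apply: Hz; rewrite !inE eqxx ?orbT.
have zx : z \in orthov ip (hol_line x).
  by apply/mem_orthov_hol_line; split; apply: Hz; rewrite !inE eqxx ?orbT.
have kcm : kappa = c * m * m.
  have /eqP := eigenvector_split symS bal x0 (Sz x xW) zx.
  by rewrite (Sz z zW) scalerA -subr_eq0 -scalerBl scaler_eq0 (negPf z0) orbF subr_eq0 => /eqP.
have lm : l = m.
  have cm0 : c * m != 0 by apply: contra_neq k0 => cm; rewrite kcm cm mul0r.
  by apply: (mulfI cm0); rewrite -kcm -clm; ring.
exists l; split; first by rewrite -clm -lm expr2.
apply/lfunP => v; rewrite scale_lfunE id_lfunE.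
pose p := orthoproj ip (hol_line y) v.
have -> : v = p + (v - p) by rewrite addrC subrK.
rewrite lfunD (Sz _ (orthoproj_orthov _ _)) -lm [RHS]scalerDr; congr (_ + _).
exact: (eigen_hol_line symS Sy (orthoproj_mem _ _)).
Qed.

(** * Dimensions two and four *)

Lemma almost_isotropic_dim2 kappa Rm :
  \dim {:V} = 2%N -> almost_isotropic ip kappa Rm.
Proof.
move=> dimV v vv.
have v0 : v != 0 by rewrite -ip_eq0 vv oner_eq0.
apply: (@leq_trans (\dim (orthov ip <[v]>)%VS)).
  by rewrite -[leqRHS](limg_ker_dim (jacobi Rm v - kappa *: \1)%VF) leq_addl.
by have := dim_orthov <[v]>%VS; rewrite dim_vline v0 dimV => /(@addnI 1 _ 1) ->.
Qed.

Lemma hol_line_dim2 x : \dim {:V} = 2%N -> x != 0 -> hol_line x = fullv.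
Proof. by move=> dimV x0; apply/eqP; rewrite eqEdim subvf dim_hol_line ?dimV. Qed.

Lemma tensorJ_dim2 : \dim {:V} = 2%N ->
  forall x y z, tensorA ip J x y z = 3 *: tensor1 ip x y z.
Proof.
move=> dimV.
have c1 := curvature_lincomb 3 0 tensor1_curvature tensor1_curvature.
move=> x y z; rewrite (curvature_ext (tensorA_curvature skewJ) c1) ?scale0r ?addr0 //.
move=> {z}{}x {}y; rewrite (sect_tensorA skewJ) scale0r addr0.
have [->|x0] := eqVneq x 0; first by rewrite !ipE; ring.
have : y \in hol_line x by rewrite hol_line_dim2 ?memvf.
move=> /hol_lineP[a [b ->]].
by rewrite /tensor1 !mapE JJ !ipE !ipJJ ipxJx ipJxx; ring.
Qed.

Lemma complex_symmetric_dim2 S : \dim {:V} = 2%N -> complex_symmetric S ->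
  exists l, S = l *: \1%VF.
Proof.
move=> dimV symS.
have [|x x0 _] := @exists_orthogonal [::]; first by rewrite dimV.
have [l Sx] : exists l, S x = l *: x.
  have /hol_lineP[l [b e]] : S x \in hol_line x by rewrite hol_line_dim2 ?memvf.
  exists l; have := complex_symmetric_ipJ x symS.
  rewrite e !ipE ipJJ ipxJx mulr0 add0r => /eqP.
  by rewrite mulf_eq0 ip_eq0 (negPf x0) orbF => /eqP->; rewrite scale0r addr0.
exists l; apply/lfunP => v; rewrite scale_lfunE id_lfunE.
have : v \in hol_line x by rewrite hol_line_dim2 ?memvf.
exact: eigen_hol_line.
Qed.

Lemma complex_symmetricD S T : complex_symmetric S -> complex_symmetric T ->
  complex_symmetric (S + T).
Proof.
move=> [sS cS] [sT cT]; split=> [x y|x]; rewrite !add_lfunE.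
  by rewrite !ipE sS sT.
by rewrite cS cT mapE.
Qed.

Lemma complex_symmetricZ a S : complex_symmetric S -> complex_symmetric (a *: S).
Proof.
move=> [sS cS]; split=> [x y|x]; rewrite !scale_lfunE.
  by rewrite !ipE sS.
by rewrite cS mapE.
Qed.

Lemma orthoproj_compl W x : orthoproj ip (orthov ip W) x = x - orthoproj ip W x.
Proof.
apply: orthoproj_unique; first exact: orthoproj_orthov.
apply/mem_orthov => v /mem_orthov /(_ _ (orthoproj_mem W x)).
by rewrite opprB addrC subrK ipC.
Qed.

Lemma orthoproj_eigen_split S y l m : complex_symmetric S -> S y = l *: y ->
  (forall z, z \in orthov ip (hol_line y) -> S z = m *: z) ->
  S = l *: orthoproj ip (hol_line y)
      + m *: orthoproj ip (orthov ip (hol_line y)).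
Proof.
move=> symS Sy Sz; apply/lfunP => x.
rewrite add_lfunE !scale_lfunE (orthoproj_compl (hol_line y)).
rewrite -(eigen_hol_line symS Sy (orthoproj_mem _ x)).
by rewrite -(Sz _ (orthoproj_orthov _ x)) -lfunD addrC subrK.
Qed.

Lemma holomorphic_orthov W : \dim {:V} = 4%N -> holomorphic_plane J W ->
  holomorphic_plane J (orthov ip W).
Proof.
move=> dimV [dimW JW]; split.
  by have := dim_orthov W; rewrite dimW dimV => /(@addnI 2 _ 2).
apply/subvP => _ /memv_imgP[u /mem_orthov uW ->]; apply/mem_orthov => v vW.
by rewrite skewJ uW ?oppr0 // (subvP JW) ?memv_img.
Qed.

Lemma orthogonal_planes_compl W1 W2 : \dim {:V} = 4%N ->
  \dim W1 = 2%N -> \dim W2 = 2%N -> orthogonal_spaces ip W1 W2 ->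
  W2 = orthov ip W1.
Proof.
move=> dimV dim1 dim2 /subvP orth; apply/eqP; rewrite eqEdim dim2.
have := dim_orthov W1; rewrite dim1 dimV => /(@addnI 2 _ 2) ->; rewrite andbT.
apply/subvP => v vW2; apply/mem_orthov => u /orth /mem_orthov /(_ _ vW2).
by rewrite ipC.
Qed.

Lemma orthogonal_orthov W : orthogonal_spaces ip W (orthov ip W).
Proof.
apply/subvP => u uW; apply/mem_orthov => v /mem_orthov /(_ _ uW).
by rewrite ipC.
Qed.

(** The defect vanishes on each plane, and on mixed pairs S multiplies it by
    mu1 * mu2. *)
Lemma balanced_two_planes W mu1 mu2 c :
  holomorphic_plane J W -> holomorphic_plane J (orthov ip W) ->
  balanced (c * (mu1 * mu2)) c
    (mu1 *: orthoproj ip W + mu2 *: orthoproj ip (orthov ip W)).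
Proof.
move=> hW hW' x y z.
pose p v := orthoproj ip W v; pose q v := orthoproj ip (orthov ip W) v.
have split_v v : v = p v + q v by rewrite /q orthoproj_compl addrC subrK.
rewrite {1}(split_v x) {1}(split_v y) !add_lfunE !scale_lfunE -!/(p _) -!/(q _).
rewrite !J_defectD !J_defectZ.
rewrite (@J_defect_plane W (p x) (p y)) ?orthoproj_mem //.
rewrite (@J_defect_plane _ (q x) (q y) z hW') ?orthoproj_mem //.
by apply: ip_inj => w; rewrite !ipE; ring.
Qed.

End InnerProduct.

(** * The classification *)

Theorem theorem2 (R : realType) (V : vectType R) (ip : {dot V for idfun})
    (J : 'End(V)) (hJ : complex_model ip J) (kappa : R) (Rm : V -> V -> V -> V) :
  [/\ \dim {:V} = 2%N ->
        (kahler_almost_isotropic ip J kappa Rm <->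
         exists k : R,
           [/\ almost_isotropic ip k Rm,
               forall x y z, Rm x y z = k *: tensor1 ip x y z &
               forall x y z, k *: tensor1 ip x y z =
                 (k / 4) *: (tensor1 ip x y z + tensorA ip J x y z)]),
      \dim {:V} = 4%N -> kappa != 0 ->
        (kahler_almost_isotropic ip J kappa Rm <->
         exists (tau mu1 mu2 : R) (W1 W2 : {vspace V}),
           [/\ tau = 1 \/ tau = -1,
               holomorphic_plane J W1 /\ holomorphic_plane J W2,
               orthogonal_spaces ip W1 W2,
               mu1 * mu2 = kappa / tau &
               let A := (J \o (mu1 *: orthoproj ip W1
                               + mu2 *: orthoproj ip W2))%VF in
               forall x y z,
                 Rm x y z = kappa *: tensor1 ip x y z
                            + tau *: tensorA ip A x y z]),
      (6 <= \dim {:V})%N -> kappa != 0 ->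
        (kahler_almost_isotropic ip J kappa Rm <->
         forall x y z,
           Rm x y z = kappa *: (tensor1 ip x y z + tensorA ip J x y z)) &
      (4 <= \dim {:V})%N -> kappa = 0 ->
        (kahler_almost_isotropic ip J kappa Rm <->
         exists (c : R) (W : {vspace V}),
           holomorphic_plane J W /\
           let A := (J \o orthoproj ip W)%VF in
           forall x y z, Rm x y z = c *: tensorA ip A x y z)].
Proof.
have [_ acs] := hJ.
have sym1 : complex_symmetric ip J \1%VF by split=> *; rewrite !id_lfunE.
have J1 : (J \o \1)%VF = J by rewrite comp_lfun1r.
have bal1 k : balanced ip J k k \1%VF by move=> x y z; rewrite !id_lfunE.
have Jscale a (B : 'End(V)) : (J \o (a *: B))%VF = a *: (J \o B)%VF.
  by rewrite comp_lfunZr.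
split=> [dimV|dimV k0|dimV k0|dimV ->].
- split=> [/(kahler_almost_isotropicP acs)[c [S [symS _ RE]]]|[k [_ RE R1E]]].
    have [l SE] := complex_symmetric_dim2 acs dimV symS.
    exists (kappa + 3 * c * l ^+ 2); split=> [|x y z|x y z].
    + exact: almost_isotropic_dim2.
    + rewrite RE /model_tensor SE Jscale J1 tensorA_scale (tensorJ_dim2 acs dimV).
      by apply: (@ip_inj _ _ ip) => w; rewrite !ipE; ring.
    + rewrite (tensorJ_dim2 acs dimV).
      by apply: (@ip_inj _ _ ip) => w; rewrite !ipE; field.
  have [cR kal _] : kahler_almost_isotropic ip J (k / 4) Rm.
    apply/(kahler_almost_isotropicP acs); exists (k / 4), \1%VF; split=> // x y z.
    by rewrite RE R1E /model_tensor J1 scalerDr.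
  by split=> //; exact: almost_isotropic_dim2.
- split=> [/(kahler_almost_isotropicP acs)[c [S [symS bal RE]]]|].
    have dim4 : (4 <= \dim {:V})%N by rewrite dimV.
    have [c0 _] := balanced_neq0 acs dim4 k0 bal.
    have [y [l [m [y0 clm Sy Sz]]]] := balanced_eigenspaces acs dim4 k0 symS bal.
    have hW := holomorphic_hol_line acs y0.
    (* Rescaling S by the square root of |c| turns the coefficient of R_A into
       the sign of c. *)
    pose r := Num.sqrt `|c|.
    have rr : r ^+ 2 = `|c| by rewrite sqr_sqrtr.
    have [tau tau1 cE] : exists2 tau : R, tau = 1 \/ tau = -1 & c = tau * r ^+ 2.
      have [cp|cn] := lerP 0 c.
        by exists 1; [left|rewrite rr ger0_norm // mul1r].
      by exists (-1); [right|rewrite rr ltr0_norm // mulrNN mul1r].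
    have tau0 : tau != 0 by case: tau1 => ->; rewrite ?oppr_eq0 oner_eq0.
    have SE : S = l *: orthoproj ip (hol_line J y)
                  + m *: orthoproj ip (orthov ip (hol_line J y)).
      exact: orthoproj_eigen_split symS Sy Sz.
    exists tau, (r * l), (r * m), (hol_line J y), (orthov ip (hol_line J y)).
    split=> //; first by split=> //; exact: holomorphic_orthov.
    + exact: orthogonal_orthov.
    + by rewrite -clm cE; field.
    + move=> A x y' z; have -> : A = r *: (J \o S)%VF.
        by rewrite -Jscale [in RHS]SE scalerDr !scalerA.
      by rewrite tensorA_scale scalerA -cE RE.
  move=> [tau [mu1 [mu2 [W1 [W2 [tau1 [h1 h2] orth mu12 RE]]]]]].
  have tau0 : tau != 0 by case: tau1 => ->; rewrite ?oppr_eq0 oner_eq0.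
  have W2E := orthogonal_planes_compl dimV h1.1 h2.1 orth.
  apply/(kahler_almost_isotropicP acs).
  exists tau, (mu1 *: orthoproj ip W1 + mu2 *: orthoproj ip W2); split=> //.
    by apply: complex_symmetricD; apply: complex_symmetricZ;
      apply: orthoproj_complex_symmetric => //; [exact: h1.2|exact: h2.2].
  have -> : kappa = tau * (mu1 * mu2) by rewrite mu12 mulrC divfK.
  by rewrite W2E in h2 *; exact: balanced_two_planes.
- split=> [/(kahler_almost_isotropicP acs)[c [S [symS bal RE]]]|RE].
    have [l [cl SE]] := balanced_scalar acs dimV k0 symS bal.
    by move=> x y z; rewrite RE /model_tensor SE Jscale J1 tensorA_scale scalerA cl [RHS]scalerDr.
  apply/(kahler_almost_isotropicP acs); exists kappa, \1%VF; split=> // x y z.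
  by rewrite RE /model_tensor J1 scalerDr.
- split=> [/(kahler_almost_isotropicP acs)[c [S [symS bal RE]]]|[c [W [hW RE]]]].
    have [R0|[c0 S0]] : (forall x y z, Rm x y z = 0) \/ c != 0 /\ S != 0.
      have [c0|c0] := eqVneq c 0.
        by left=> x y z; rewrite RE c0 /model_tensor !scale0r addr0.
      have [S0|S0] := eqVneq S 0; last by right.
      left=> x y z; rewrite RE S0 /model_tensor comp_lfun0r tensorA0.
      by rewrite scale0r scaler0 addr0.
    + have [|x x0 _] := @exists_orthogonal _ _ ip [::].
        exact: leq_trans dimV.
      exists 0, (hol_line J x); split; first exact: (holomorphic_hol_line acs).
      by move=> A x' y z; rewrite R0 scale0r.
    + have [a [W [hW SE]]] := rank_one_complex_symmetric acs symS c0 bal S0.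
      exists (c * a ^+ 2), W; split=> // A x y z.
      by rewrite RE /model_tensor SE Jscale tensorA_scale scalerA scale0r add0r.
  apply/(kahler_almost_isotropicP acs); exists c, (orthoproj ip W); split.
  + by apply: orthoproj_complex_symmetric hW.2.
  + by move=> x y z; rewrite scale0r (J_defect_plane acs _ hW) ?orthoproj_mem // scaler0.
  + by move=> x y z; rewrite RE /model_tensor scale0r add0r.
Qed.
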